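(* Let $s\ge 3$ be an integer, $\gamma>0$, and let $G$ be a $(2s,\gamma)$-good graph on $n$ vertices. Then \[ w\text{-}sat(G,K_s)=(s-2)n-\binom{s-1}{2}. \]
   Context: Given a graph $G$ and a vertex set $X$, a clique extension of $X$ is a vertex set $Y$ disjoint from $X$ such that $G[Y]$ is a clique and every vertex of $X$ is adjacent to every vertex of $Y$; its size is $|Y|$. A graph $G$ on $n$ vertices is $(t,\gamma)$-good if: (P1) for any vertex set $X$ of size $x$ and any integer $y$ with $x,y\le t$, $G$ contains at least $\gamma n$ pairwise disjoint clique extensions of $X$ of size $y$; and (P2) for any two disjoint vertex sets $S$ and $T$ each of size at least $\gamma n/2$, there is a vertex $v\in T$ and a set $X\subseteq S$ of size $t-1$ such that $X\cup\{v\}$ induces a clique in $G$. $K_s$ is the complete graph on $s$ vertices. A subgraph $H\subseteq G$ is weakly $K_s$-saturated in $G$ if $H$ contains no copy of $K_s$, but the edges of $G$ missing from $H$ can be added one by one in some order so that each added edge creates a new copy of $K_s$; $w\text{-}sat(G,K_s)$ is the minimum number of edges of such an $H$. *)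

(* Defs.v *)
From HB Require Import structures.
From mathcomp Require Import all_boot all_order all_algebra.
From mathcomp Require Import reals.

Set Implicit Arguments.
Unset Strict Implicit.
Unset Printing Implicit Defensive.

Import Order.TTheory GRing.Theory Num.Theory.

Section Graphs.

Variable V : finType.

Definition clique (e : rel V) (K : {set V}) : bool :=
  [forall x in K, forall y in K, (x != y) ==> e x y].

Definition clique_extension (e : rel V) (X Y : {set V}) : bool :=
  [&& [disjoint X & Y], clique e Y & [forall x in X, forall y in Y, e x y]].

Definition edges (e : rel V) : {set {set V}} :=
  [set [set p.1; p.2] | p : V * V & e p.1 p.2].

(* A subgraph H of G is given by its edge set F, a subset of edges G; its
   vertex set is all of V, as isolated vertices affect neither the copies of
   K_s (s >= 2) nor the number of edges. *)
Definition edge_rel (F : {set {set V}}) : rel V :=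
  fun x y => [set x; y] \in F.

(* A copy of K_s in a graph is determined by its vertex set. *)
Definition copyK (s : nat) (F : {set {set V}}) (K : {set V}) : bool :=
  (#|K| == s) && clique (edge_rel F) K.

Definition K_free (s : nat) (F : {set {set V}}) : bool :=
  [forall K : {set V}, ~~ copyK s F K].

Definition creates_copyK (s : nat) (F : {set {set V}}) (f : {set V}) : bool :=
  [exists K : {set V}, copyK s (f |: F) K && ~~ copyK s F K].

Fixpoint saturating_order (s : nat) (F : {set {set V}}) (r : seq {set V})
    : bool :=
  if r is f :: r' then creates_copyK s F f && saturating_order s (f |: F) r'
  else true.

Definition completable (s : nat) (e : rel V) (F : {set {set V}}) : bool :=
  has (saturating_order s F) (permutations (enum (edges e :\: F))).

Definition weakly_saturated (s : nat) (e : rel V) (F : {set {set V}}) : bool :=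
  [&& F \subset edges e, K_free s F & completable s e F].

(* The default value #|edges e| of the minimum is harmless: it bounds #|F| for
   every F \subset edges e, and the minimum is over a nonempty family for
   s >= 2; see wsat_attained and wsat_le. *)
Definition wsat (e : rel V) (s : nat) : nat :=
  \big[minn/#|edges e|]_(F : {set {set V}} | weakly_saturated s e F) #|F|.

Lemma wsat_le (e : rel V) (s : nat) (F : {set {set V}}) :
  weakly_saturated s e F -> wsat e s <= #|F|.
Proof.
move=> wF; rewrite /wsat.
have : F \in index_enum {set {set V}} by rewrite mem_index_enum.
elim: (index_enum _) => // G r IHr; rewrite inE big_cons => /predU1P[<-|/IHr leF].
  by rewrite wF geq_minl.
by case: ifP => // _; rewrite geq_min leF orbT.
Qed.

Lemma weakly_saturated_exists (e : rel V) (s : nat) :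
  2 <= s -> exists F, weakly_saturated s e F.
Proof.
move=> s2.
suff H n (F : {set {set V}}) : #|F| <= n -> F \subset edges e ->
    completable s e F -> exists F, weakly_saturated s e F.
  apply: (H _ (edges e) (leqnn _)) => //.
  by apply/hasP; exists [::]; rewrite // mem_permutations setDv enum_set0.
elim: n F => [|n IHn] F leFn sF cF; last first.
  have [free|/forallPn [K]] := boolP (K_free s F).
    by exists F; rewrite /weakly_saturated sF free cF.
  rewrite negbK => cK; have /andP[/eqP sK clK] := cK.
  have /card_gt1P [x [y [xK yK xy]]] : 1 < #|K| by rewrite sK.
  pose f := [set x; y].
  have fF : f \in F.
    by move/forall_inP/(_ x xK)/forall_inP/(_ y yK)/implyP/(_ xy): clK.
  apply: (IHn (F :\ f)).
  - by move: leFn; rewrite (cardsD1 f) fF.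
  - exact: subset_trans (subsetDl _ _) sF.
  - have /hasP [r] := cF; rewrite mem_permutations => pr or.
    apply/hasP; exists (f :: r).
      rewrite mem_permutations uniq_perm ?enum_uniq //=.
        rewrite (perm_uniq pr) enum_uniq andbT (perm_mem pr) mem_enum.
        by rewrite inE fF.
      move=> g; rewrite inE (perm_mem pr) !mem_enum !inE.
      case: (altP (g =P f)) => [->|gf] //=.
      by rewrite (subsetP sF _ fF).
    rewrite /= setD1K // or andbT; apply/existsP; exists K.
    rewrite setD1K // cK /=; apply/negP => /andP[_].
    move/forall_inP/(_ x xK)/forall_inP/(_ y yK)/implyP/(_ xy).
    by rewrite /edge_rel !inE eqxx.
have F0 : F = set0 by apply/eqP; rewrite -cards_eq0 -leqn0.
exists F; rewrite /weakly_saturated sF cF andbT /=.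
apply/forallP => K; apply/negP => /andP[/eqP sK].
have /card_gt1P [x [y [xK yK xy]]] : 1 < #|K| by rewrite sK.
move/forall_inP/(_ x xK)/forall_inP/(_ y yK)/implyP/(_ xy).
by rewrite /edge_rel F0 inE.
Qed.

Lemma wsat_attained (e : rel V) (s : nat) :
  2 <= s -> exists2 F, weakly_saturated s e F & wsat e s = #|F|.
Proof.
move=> s2; have [F0 wF0] := weakly_saturated_exists e s2.
have [F wF minF] := arg_minnP (fun F : {set {set V}} => #|F|) wF0.
exists F => //; apply/eqP; rewrite eqn_leq wsat_le //=.
rewrite /wsat; elim/big_ind: _ => [|a b la lb|]; last exact: minF.
  by have /and3P[/subset_leq_card] := wF.
by rewrite leq_min la.
Qed.

Local Open Scope ring_scope.

(* The disjoint clique extensions form a family indexed by 'I_k rather than a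
   set of sets, so that the case y = 0 imposes nothing. *)
Definition good (R : realType) (t : nat) (gamma : R) (e : rel V) : Prop :=
  (forall (X : {set V}) (y : nat), (#|X| <= t)%N -> (y <= t)%N ->
     exists (k : nat) (Y : 'I_k -> {set V}),
       [/\ gamma * #|V|%:R <= k%:R,
           forall i, #|Y i| = y /\ clique_extension e X (Y i) &
           forall i j, i != j -> [disjoint Y i & Y j]])
  /\
  (forall S T : {set V}, [disjoint S & T] ->
     gamma * #|V|%:R / 2 <= #|S|%:R -> gamma * #|V|%:R / 2 <= #|T|%:R ->
     exists (v : V) (X : {set V}),
       [/\ v \in T, X \subset S, #|X| = t.-1 & clique e (v |: X)]).

End Graphs.

(* Main.v *)
(** Put d = s - 2.  An edge uw may be added exactly when u and w have d common
    neighbours forming a clique, that is, when {u, w} has a clique extension of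
    size d in the current graph.

    Upper bound: fix a d-clique C with common neighbourhood N.  Join the
    vertices of N to C, and every other vertex v to a d-clique of N(v) inside N.
    The edges inside N can be added first, because of C.  Then any edge vu with
    u in N: take a d-clique Z in N extending {v, u} and the clique attached to
    v; the attached clique yields the edges from v to Z, and Z yields vu.  The
    remaining edges uw follow from a d-clique in N extending {u, w}.

    Lower bound: attach distinct numbers t_x to the vertices.  For polynomials
    f_x of degree less than d, the equations f_x(t_y) = f_y(t_x) for all pairs
    of a K_s but one imply the last one, by interpolation at the other d
    vertices.  Hence the equations of a weakly saturated F imply those of G, and
    then all of them since every nonedge of G completes a K_s.  All equations
    together with the vanishing of f_x(t_y) for the C(d+1,2) unordered pairs
    (x = y allowed) from a fixed d-set force f = 0, so |F| + C(d+1,2) is at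
    least the dimension d n of the space of families (f_x). *)
Require Import Defs.
From HB Require Import structures.
From mathcomp Require Import all_boot all_order all_algebra.
From mathcomp Require Import reals zify.

Set Implicit Arguments.
Unset Strict Implicit.
Unset Printing Implicit Defensive.

Import Order.TTheory GRing.Theory Num.Theory.

Section Cliques.

Variable V : finType.
Implicit Types (e r : rel V) (K X Y : {set V}) (u v w x y : V).

Lemma cliqueP e K :
  reflect {in K &, forall x y, x != y -> e x y} (clique e K).
Proof.
apply: (iffP forall_inP) => [cK x y xK yK|cK x xK].
  by move/forall_inP/(_ y yK)/implyP: (cK x xK).
by apply/forall_inP => y yK; apply/implyP; apply: cK.
Qed.

Lemma clique_extensionP e X Y :
  reflect [/\ [disjoint X & Y], clique e Y & {in X & Y, forall x y, e x y}]
          (clique_extension e X Y).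
Proof.
apply: (iffP and3P) => -[dXY cY eXY]; split=> //.
  by move=> x y xX yY; move/forall_inP/(_ x xX)/forall_inP/(_ y yY): eXY.
by apply/forall_inP => x xX; apply/forall_inP => y yY; apply: eXY.
Qed.

Lemma clique_extension2P e u w Y :
  reflect [/\ u \notin Y, w \notin Y, clique e Y,
              {in Y, forall y, e u y} & {in Y, forall y, e w y}]
          (clique_extension e [set u; w] Y).
Proof.
apply: (iffP (clique_extensionP _ _ _)) => [[dY cY eY]|[uY wY cY eu ew]].
  split=> // [||y|y].
  - by rewrite (disjointFr dY) ?set21.
  - by rewrite (disjointFr dY) ?set22.
  - by apply: eY; rewrite set21.
  - by apply: eY; rewrite set22.
split=> // [|x y /set2P[]->]; [|exact: eu|exact: ew].
by rewrite disjoint_subset; apply/subsetP => x /set2P[]->.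
Qed.

Lemma sub_in_clique e r K : {in K &, subrel e r} -> clique e K -> clique r K.
Proof.
by move=> er /cliqueP cK; apply/cliqueP => x y xK yK /cK exy; apply/er/exy.
Qed.

Lemma clique_extension_subrel e r X Y :
  subrel e r -> clique_extension e X Y -> clique_extension r X Y.
Proof.
move=> er /clique_extensionP[dXY cY eXY]; apply/clique_extensionP; split=> //.
  by apply: sub_in_clique cY => x y _ _; apply: er.
by move=> x y xX yY; apply/er/eXY.
Qed.

Lemma clique_extension_setU e X Y :
  symmetric e -> clique e X -> clique_extension e X Y -> clique e (X :|: Y).
Proof.
move=> e_sym /cliqueP cX /clique_extensionP[_ /cliqueP cY eXY].
apply/cliqueP => x y /setUP[xX|xY] /setUP[yX|yY] xy.
- exact: cX.
- exact: eXY.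
- by rewrite e_sym eXY.
- exact: cY.
Qed.

Definition extension_closed (d : nat) e r : Prop :=
  forall u w Y, e u w -> #|Y| = d -> clique_extension r [set u; w] Y -> r u w.

Definition clique_extendable e (U : {set V}) (m d : nat) : Prop :=
  forall X, #|X| <= m ->
    exists Z : {set V}, [/\ #|Z| = d, Z \subset U & clique_extension e X Z].

Definition common_nbrs e X : {set V} := [set v | [forall x in X, e x v]].

Lemma common_nbrsP e X v :
  reflect {in X, forall x, e x v} (v \in common_nbrs e X).
Proof. by rewrite inE; apply: forall_inP. Qed.

Lemma clique_extendable_common_nbrs e X m d :
  clique_extendable e setT (#|X| + m) d ->
  clique_extendable e (common_nbrs e X) m d.
Proof.
move=> ext W leW.
have [|Z [cZ _ /clique_extensionP[dZ clZ eZ]]] := ext (X :|: W).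
  by apply: leq_trans (leq_card_setU _ _) _; rewrite leq_add2l.
exists Z; split=> //.
  apply/subsetP => z zZ; apply/common_nbrsP => x xX.
  by apply: eZ; rewrite // inE xX.
apply/clique_extensionP; split=> // [|x z xW zZ].
  exact: disjointWl (subsetUr _ _) dZ.
by apply: eZ; rewrite // inE xW orbT.
Qed.

End Cliques.

Section WeakSaturation.

Variable V : finType.
Implicit Types (d s : nat) (e r : rel V) (u w x y : V).
Implicit Types (f K Y : {set V}) (F : {set {set V}}).

Lemma set2_inj u w x y :
  [set u; w] = [set x; y] -> (u = x /\ w = y) \/ (u = y /\ w = x).
Proof.
move=> /setP E; move: (E u) (E w) (E x) (E y); rewrite !inE !eqxx ?orbT.
move=> /esym/orP[]/eqP-> /esym/orP[]/eqP-> xuw yuw; [|by left|by right|].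
  by move: yuw; rewrite orbb => /eqP->; left.
by move: xuw; rewrite orbb => /eqP->; left.
Qed.

Lemma edgesP e f :
  reflect (exists u w, e u w /\ f = [set u; w]) (f \in edges e).
Proof.
apply: (iffP imsetP) => [[[u w]]|[u [w [euw ->]]]].
  by rewrite inE /= => euw ->; exists u, w.
by exists (u, w); rewrite ?inE.
Qed.

Lemma edge_relC F : symmetric (edge_rel F).
Proof. by move=> x y; rewrite /edge_rel setUC. Qed.

Lemma creates_copyK_extension d F u w :
  u != w -> creates_copyK d.+2 F [set u; w] ->
  exists2 Y : {set V}, #|Y| = d & clique_extension (edge_rel F) [set u; w] Y.
Proof.
move=> uw /existsP[K /andP[/andP[cK /cliqueP clK]]].
rewrite /copyK cK /= => /forall_inPn[x xK] /forall_inPn[y yK].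
rewrite negb_imply => /andP[xy xyF].
have Exy : [set x; y] = [set u; w].
  by have /setU1P[//|/(negP xyF)] := clK x y xK yK xy.
have uwK : [set u; w] \subset K by rewrite -Exy subUset !sub1set xK.
have clF a b :
    a \in K -> b \in K -> a != b -> b \notin [set u; w] -> edge_rel F a b.
  move=> aK bK ab buw; have /setU1P[ab_uw|//] := clK a b aK bK ab.
  by rewrite -ab_uw set22 in buw.
exists (K :\: [set u; w]).
  have := cardsID [set u; w] K.
  by rewrite (setIidPr uwK) cards2 uw (eqP cK) => -[].
apply/clique_extensionP; split.
- by rewrite disjoint_sym disjoints_subset setDE subsetIr.
- by apply/cliqueP => a b /setDP[aK _] /setDP[bK buw] ab; apply: clF.
- move=> a b auw /setDP[bK buw]; apply: clF => //.
    exact: subsetP auw.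
  by apply: contraNneq buw => <-.
Qed.

Lemma clique_extension_creates_copyK F u w Y :
  u != w -> [set u; w] \notin F -> clique_extension (edge_rel F) [set u; w] Y ->
  creates_copyK #|Y|.+2 F [set u; w].
Proof.
move=> uw uwF extY; have /clique_extensionP[dY _ _] := extY.
apply/existsP; exists ([set u; w] :|: Y); apply/andP; split.
  rewrite /copyK cardsU (disjoint_setI0 dY) cards0 cards2 uw subn0 eqxx.
  apply: clique_extension_setU (edge_relC _) _ _.
    apply/cliqueP => a b /set2P[]-> /set2P[]->; rewrite ?eqxx // => _.
      exact: setU11.
    by rewrite edge_relC; apply: setU11.
  by apply: clique_extension_subrel extY => a b abF; apply/setUP; right.
by apply: contra uwF => /andP[_ /cliqueP]; apply; rewrite // !inE eqxx ?orbT.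
Qed.

Lemma completable_setU1 s e F f :
  f \in edges e -> f \notin F -> creates_copyK s F f ->
  completable s e (f |: F) -> completable s e F.
Proof.
move=> fe fF cf /hasP[p]; rewrite mem_permutations => p_perm p_sat.
apply/hasP; exists (f :: p); rewrite /= ?cf // mem_permutations.
have -> : edges e :\: F = f |: (edges e :\: (f |: F)).
  by apply/setP => g; rewrite !inE; case: eqP => [->|]; rewrite ?fF ?fe.
apply: uniq_perm => [||g]; rewrite ?enum_uniq //=.
  by rewrite (perm_uniq p_perm) enum_uniq (perm_mem p_perm) mem_enum !inE eqxx.
by rewrite inE (perm_mem p_perm) !mem_enum !inE.
Qed.

Lemma edges_sub_completable s e F : edges e \subset F -> completable s e F.
Proof.
rewrite -setD_eq0 => /eqP eF; apply/hasP; exists [::] => //.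
by rewrite mem_permutations eF enum_set0.
Qed.

(* A completable edge set of minimum size is K_s-free: an edge of a copy of K_s
   can be removed, since the copy creates it again. *)
Lemma wsat_le_completable s e F :
  2 <= s -> F \subset edges e -> completable s e F -> wsat e s <= #|F|.
Proof.
move=> s_gt1 sF cF; pose P F := (F \subset edges e) && completable s e F.
have PF : P F by rewrite /P sF.
have [G /andP[sG cG] minG] := arg_minnP (fun F => #|F|) PF.
apply: leq_trans (minG F PF); apply: wsat_le.
rewrite /weakly_saturated sG cG andbT; apply/forallP => K; apply/negP => cK.
have /andP[/eqP sK /cliqueP clK] := cK.
have /card_gt1P[x [y [xK yK xy]]] : 1 < #|K| by rewrite sK.
pose f := [set x; y]; have fG : f \in G := clK x y xK yK xy.
suff /minG : P (G :\ f) by rewrite (cardsD1 f G) fG ltnn.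
rewrite /P (subset_trans (subsetDl _ _) sG) /=.
apply: (completable_setU1 (subsetP sG f fG)); rewrite ?setD1K ?setD11 //.
apply/existsP; exists K; rewrite setD1K // cK.
by apply/negP => /andP[_ /cliqueP/(_ x y xK yK xy)]; rewrite /edge_rel setD11.
Qed.

Section ClosedRelations.

Variables (d : nat) (e : rel V).
Hypothesis e_irr : irreflexive e.

Lemma edge_neq u w : e u w -> u != w.
Proof. by apply: contraTneq => ->; rewrite e_irr. Qed.

Lemma creates_copyK_subrel r F f :
  symmetric r -> extension_closed d e r -> subrel (edge_rel F) r ->
  f \in edges e -> creates_copyK d.+2 F f -> subrel (edge_rel (f |: F)) r.
Proof.
move=> r_sym r_closed Fr /edgesP[u [w [euw ->]]].
move=> /(creates_copyK_extension (edge_neq euw))[Y cY extY].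
have ruw : r u w := r_closed u w Y euw cY (clique_extension_subrel Fr extY).
move=> x y /setU1P[/set2_inj[] [-> ->] //|]; [by rewrite r_sym|exact: Fr].
Qed.

Lemma completable_subrel r F :
  symmetric r -> extension_closed d e r -> subrel (edge_rel F) r ->
  completable d.+2 e F -> subrel e r.
Proof.
move=> r_sym r_closed Fr /hasP[p]; rewrite mem_permutations => p_perm p_sat.
have pe : {subset p <= edges e}.
  by move=> f; rewrite (perm_mem p_perm) mem_enum => /setDP[].
suff sub : subrel (edge_rel (F :|: [set:: p])) r.
  move=> u w euw; apply: sub.
  rewrite /edge_rel !inE (perm_mem p_perm) mem_enum inE.
  by case: (_ \in F) => //=; apply/edgesP; exists u, w.
elim: p F Fr p_sat pe {p_perm} => [|f p IHp] F Fr /=.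
  by move=> _ _ x y /setUP[/Fr //|]; rewrite inE.
case/andP=> cf p_sat pe x y.
have pe' : {subset p <= edges e} by move=> g gp; apply: pe; rewrite inE gp orbT.
have Ffr := creates_copyK_subrel r_sym r_closed Fr (pe f (mem_head f p)) cf.
move=> xyFp; apply: (IHp _ Ffr p_sat pe'); move: xyFp.
by rewrite /edge_rel !inE orbCA orbA.
Qed.

Lemma extension_closed_completable F :
  (forall r, symmetric r -> extension_closed d e r -> subrel (edge_rel F) r ->
     subrel e r) ->
  completable d.+2 e F.
Proof.
have [n] := ubnP #|edges e :\: F|; elim: n F => // n IHn F ltn Fgen.
have [/existsP[f /and3P[fe fF cf]]|no_new] :=
    boolP [exists f, [&& f \in edges e, f \notin F & creates_copyK d.+2 F f]].
  apply: (completable_setU1 fe fF cf); apply: IHn => [|r r_sym r_closed fFr].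
    by move: ltn; rewrite (cardsD1 f) !inE fe fF ltnS setDDl setUC.
  apply: Fgen => // x y xyF; exact/fFr/setU1r.
apply: edges_sub_completable; apply/subsetP => f /edgesP[u [w [euw ->]]].
apply: (Fgen (edge_rel F)) euw => //; first exact: edge_relC.
move=> x y Y exy cY extY; apply: contraNT no_new => xyF.
apply/existsP; exists [set x; y]; rewrite xyF; apply/andP; split.
  by apply/edgesP; exists x, y.
rewrite -cY; apply: clique_extension_creates_copyK extY => //.
exact: edge_neq.
Qed.

End ClosedRelations.

End WeakSaturation.

Section UpperBound.

Variables (V : finType) (d : nat) (e : rel V).
Hypotheses (e_sym : symmetric e) (e_irr : irreflexive e).
Implicit Types (C U : {set V}) (Y : V -> {set V}).

Lemma extension_closed_spread (r : rel V) U :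
  symmetric r -> extension_closed d e r -> {in U &, subrel e r} ->
  (forall v, v \notin U -> exists Y : {set V},
     [/\ #|Y| = d, Y \subset U, clique e Y & {in Y, forall y, r v y}]) ->
  clique_extendable e U d.+2 d -> subrel e r.
Proof.
move=> r_sym r_closed rU attached ext.
have clique_r (Z : {set V}) : Z \subset U -> clique e Z -> clique r Z.
  by move=> /subsetP ZU; apply: sub_in_clique => x y /ZU xU /ZU yU; apply: rU.
have r_into_U v u : u \in U -> e v u -> r v u.
  move=> uU evu; have [vU|vU] := boolP (v \in U); first exact: rU.
  have [Y [cY YU clY rvY]] := attached v vU.
  have [|Z [cZ ZU /clique_extensionP[dZ clZ eZ]]] := ext (u |: (v |: Y)).
    by rewrite !cardsU1 cY; case: (_ \notin _); case: (_ \notin _); lia.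
  have euZ : {in Z, forall z, e u z} by move=> z; apply: eZ; rewrite !inE eqxx.
  have rvZ : {in Z, forall z, r v z}.
    move=> z zZ; apply: (r_closed v z Y) => //.
      by apply: eZ; rewrite // !inE eqxx orbT.
    apply/clique_extension2P; split=> // [|||y yY].
    - by apply: contra vU; apply: subsetP.
    - by apply: contraTN zZ => zY; rewrite (disjointFr dZ) // !inE zY !orbT.
    - exact: clique_r.
    - rewrite r_sym; apply: rU; [exact: subsetP yY|exact: subsetP zZ|].
      by apply: eZ; rewrite // !inE yY !orbT.
  apply: (r_closed v u Z) => //; apply/clique_extension2P; split=> //.
  - by rewrite (disjointFr dZ) // !inE eqxx orbT.
  - by rewrite (disjointFr dZ) // !inE eqxx.
  - exact: clique_r.
  - by move=> z zZ; apply: rU; [|exact: subsetP zZ|exact: euZ].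
move=> u w euw.
have [|Z [cZ ZU /clique_extensionP[dZ clZ eZ]]] := ext [set u; w].
  by rewrite cards2; case: (_ != _).
apply: (r_closed u w Z) => //; apply/clique_extensionP; split=> //.
  exact: clique_r.
by move=> x z xuw zZ; apply: r_into_U; [exact: subsetP zZ|exact: eZ].
Qed.

Definition seed_edges C Y : {set {set V}} :=
  [set f : {set V} | f \subset C & #|f| == 2] :|:
  \bigcup_(v in ~: C) [set [set v; y] | y in Y v].

Lemma seed_edges_core C Y x y :
  x \in C -> y \in C -> x != y -> edge_rel (seed_edges C Y) x y.
Proof.
move=> xC yC xy; apply/setUP; left.
by rewrite inE cards2 xy eqxx subUset !sub1set xC yC.
Qed.

Lemma seed_edges_attach C Y v y :
  v \notin C -> y \in Y v -> edge_rel (seed_edges C Y) v y.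
Proof.
move=> vC yY; apply/setUP; right; apply/bigcupP; exists v; first by rewrite inE.
exact: imset_f.
Qed.

Lemma card_seed_edges C Y :
  #|C| = d -> (forall v, #|Y v| = d) ->
  #|seed_edges C Y| + 'C(d.+1, 2) <= d * #|V|.
Proof.
move=> cC cY.
have le_attach :
    #|\bigcup_(v in ~: C) [set [set v; y] | y in Y v]| <= #|~: C| * d.
  rewrite -sum_nat_const.
  apply: (big_rec2 (fun (A : {set {set V}}) m => #|A| <= m)).
    by rewrite cards0.
  move=> v m A _ leA; apply: leq_trans (leq_card_setU _ _) _.
  by rewrite leq_add // (leq_trans (leq_imset_card _ _)) ?cY.
have sum_bin : 'C(d, 2) + 'C(d.+1, 2) = d * d.
  by rewrite binS bin1; have := mul_bin_left d 1; rewrite bin1; nia.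
have le_seed : #|seed_edges C Y| <= 'C(d, 2) + #|~: C| * d.
  by apply: leq_trans (leq_card_setU _ _) _; rewrite cards_draws cC leq_add2l.
have := cardsC C; nia.
Qed.

Definition attachment C v (Z : {set V}) : Prop :=
  [/\ #|Z| = d, clique e Z, {in Z, forall z, e v z} &
   if v \in common_nbrs e C then Z = C else Z \subset common_nbrs e C].

Lemma attachment_exists C v :
  #|C| = d -> clique e C -> clique_extendable e (common_nbrs e C) 1 d ->
  exists Z, attachment C v Z.
Proof.
rewrite /attachment => cC clC ext.
have [vN|vN] := boolP (v \in common_nbrs e C).
  exists C; split=> // c c_in_C; rewrite e_sym.
  exact: (common_nbrsP _ _ _ vN).
have [|Z [cZ ZN /clique_extensionP[_ clZ eZ]]] := ext [set v].
  by rewrite cards1.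
by exists Z; split=> // z; apply: eZ; rewrite set11.
Qed.

Lemma seed_edges_sub C Y :
  clique e C -> (forall v, attachment C v (Y v)) ->
  seed_edges C Y \subset edges e.
Proof.
move=> /cliqueP clC attY.
rewrite subUset; apply/andP; split; apply/subsetP => f.
  rewrite inE => /andP[fC /cards2P[x [y [xy Ef]]]]; move: fC; rewrite Ef.
  rewrite subUset !sub1set => /andP[xC yC].
  by apply/edgesP; exists x, y; split=> //; apply: clC.
case/bigcupP=> v _ /imsetP[y yY ->]; apply/edgesP; exists v, y; split=> //.
by have [_ _ eY _] := attY v; apply: eY.
Qed.

Lemma seed_edges_completable C Y :
  #|C| = d -> (forall v, attachment C v (Y v)) ->
  clique_extendable e (common_nbrs e C) d.+2 d ->
  completable d.+2 e (seed_edges C Y).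
Proof.
move=> cC attY ext.
apply: extension_closed_completable => // r r_sym r_closed seed_r.
pose N := common_nbrs e C.
have NC v : v \in N -> v \notin C.
  by move=> /common_nbrsP vN; apply/negP => /vN; rewrite e_irr.
have rNC v c : v \in N -> c \in C -> r v c.
  move=> vN c_in_C; apply/seed_r/seed_edges_attach; first exact: NC.
  by have [_ _ _] := attY v; rewrite vN => ->.
apply: (extension_closed_spread r_sym r_closed _ _ ext) => [u w uN wN euw|v vN].
  apply: (r_closed u w C) => //; apply/clique_extension2P; split.
  - exact: NC.
  - exact: NC.
  - by apply/cliqueP => x y xC yC xy; apply/seed_r/seed_edges_core.
  - by move=> c; apply: rNC.
  - by move=> c; apply: rNC.
have [cY clY eY] := attY v; rewrite (negPf vN) => YN; exists (Y v); split=> //.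
move=> y yY; have [vC|vC] := boolP (v \in C); last first.
  exact/seed_r/seed_edges_attach.
by rewrite r_sym rNC // (subsetP YN).
Qed.

Lemma wsat_upper_bound :
  clique_extendable e setT (d + d.+2) d ->
  wsat e d.+2 + 'C(d.+1, 2) <= d * #|V|.
Proof.
move=> ext; have [|C [cC _ /clique_extensionP[_ clC _]]] := ext set0.
  by rewrite cards0.
have extN : clique_extendable e (common_nbrs e C) d.+2 d.
  by apply: clique_extendable_common_nbrs; rewrite cC.
have /fin_all_exists[Y attY] v : exists Z, attachment C v Z.
  by apply: attachment_exists => // X leX; apply/extN/(leq_trans leX).
have cY v : #|Y v| = d by have [] := attY v.
apply: leq_trans (card_seed_edges cC cY); rewrite leq_add2r.
apply: wsat_le_completable => //; first exact: seed_edges_sub.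
exact: seed_edges_completable.
Qed.

End UpperBound.

Local Open Scope ring_scope.

Section Lagrange.

Variables (F : fieldType) (I : finType) (t : I -> F).
Hypothesis t_inj : injective t.
Implicit Types (Y : {set I}) (p : {poly F}).

(* Unlike qpoly.lagrange, whose nodes form an injective sequence nat -> F. *)
Definition lagrange_poly Y y : {poly F} :=
  (\prod_(z in Y :\ y) (t y - t z))^-1 *: \prod_(z in Y :\ y) ('X - (t z)%:P).

Lemma size_lagrange_poly Y y : y \in Y -> (size (lagrange_poly Y y) <= #|Y|)%N.
Proof.
move=> yY; apply: leq_trans (size_scale_leq _ _) _.
by rewrite -big_enum size_prod_XsubC -cardE (cardsD1 y Y) yY.
Qed.

Lemma horner_lagrange_poly Y y z :
  y \in Y -> z \in Y -> (lagrange_poly Y y).[t z] = (y == z)%:R.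
Proof.
move=> yY zY; rewrite hornerZ horner_prod.
under [X in _ * X]eq_bigr => x _ do rewrite hornerXsubC.
have [<-|yz] := eqVneq y z.
  rewrite mulVf //; apply/prodf_neq0 => x /setD1P[xy _].
  by rewrite subr_eq0 (inj_eq t_inj) eq_sym.
rewrite [X in _ * X](bigD1 z) /=; first by rewrite subrr mul0r mulr0.
by rewrite !inE eq_sym yz.
Qed.

Lemma lagrange_interpolation Y p :
  (size p <= #|Y|)%N -> p = \sum_(y in Y) p.[t y] *: lagrange_poly Y y.
Proof.
move=> sp; apply/eqP; rewrite -subr_eq0; apply/eqP.
apply: (@roots_geq_poly_eq0 _ _ [seq t y | y <- enum Y]).
- apply/allP => _ /mapP[y + ->]; rewrite mem_enum => yY.
  rewrite rootE hornerD hornerN horner_sum (bigD1 y) //= big1.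
    by rewrite hornerZ horner_lagrange_poly // eqxx mulr1 addr0 subrr.
  move=> z /andP[zY zy].
  by rewrite hornerZ horner_lagrange_poly // (negPf zy) mulr0.
- by rewrite map_inj_uniq ?enum_uniq.
- rewrite size_map -cardE (leq_trans (size_polyD _ _)) // size_polyN geq_max sp.
  apply: leq_trans (size_sum _ _ _) _; apply/bigmax_leqP => y yY.
  exact: leq_trans (size_scale_leq _ _) (size_lagrange_poly yY).
Qed.

End Lagrange.

Lemma leq_dim_separating (F : fieldType) (vT : vectType F) (I : finType)
    (phi : I -> {scalar vT}) :
  (forall v, (forall i, phi i v = 0) -> v = 0) -> (\dim {:vT} <= #|I|)%N.
Proof.
move=> separates; pose b := vbasis {:vT}.
pose A := \matrix_(k < \dim {:vT}, j < #|I|) phi (enum_val j) b`_k.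
suff /eqP <- : row_free A by exact: rank_leq_col.
apply: inj_row_free => v vA; apply/rowP => k; rewrite mxE; move: k.
have /freeP := basis_free (vbasisP {:vT}); apply; apply: separates => i.
have /rowP/(_ (enum_rank i)) := vA; rewrite !mxE => <-.
by rewrite linear_sum; apply: eq_bigr => j _; rewrite linearZ /= mxE enum_rankK.
Qed.

Lemma card_tagged_ordS (n : nat) : #|{: {i : 'I_n & 'I_i.+1}}| = 'C(n.+1, 2).
Proof.
rewrite card_tagged sumnE big_map big_enum /= -bin2_sum big_nat_recl // add0n.
by rewrite big_mkord; apply: eq_bigr => i _; rewrite card_ord.
Qed.

Section Compatibility.

Variables (F : fieldType) (V : finType) (t : V -> F) (d : nat).
Hypothesis t_inj : injective t.
Implicit Types (f : {ffun V -> {poly_d F}}) (x y : V).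

Definition horner_node x y f : F := (f x).[t y].

Fact horner_node_is_scalar x y : scalar (horner_node x y).
Proof. by move=> a f g; rewrite /horner_node !ffunE hornerD hornerZ. Qed.

HB.instance Definition _ x y :=
  GRing.isLinear.Build F {ffun V -> {poly_d F}} F *%R (horner_node x y)
    (horner_node_is_scalar x y).

Definition compatible f : rel V :=
  fun x y => horner_node x y f == horner_node y x f.

Lemma compatibleC f : symmetric (compatible f).
Proof. by move=> x y; rewrite /compatible eq_sym. Qed.

Lemma horner_node_interpolation f (Y : {set V}) x y :
  #|Y| = d ->
  horner_node x y f =
    \sum_(z in Y) horner_node x z f * (lagrange_poly t Y z).[t y].
Proof.
move=> cY; have size_fx : (size (f x) <= #|Y|)%N by rewrite cY size_npoly.
rewrite {1}/horner_node (lagrange_interpolation t_inj size_fx) horner_sum.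
by apply: eq_bigr => z _; rewrite hornerZ.
Qed.

(* Expanding f_u(t_w) and f_w(t_u) at the nodes of Y twice, through f_y(t_u) and
   f_y(t_w), gives the same bilinear expression in the values f_y(t_z). *)
Lemma compatible_extension f (Y : {set V}) u w :
  #|Y| = d -> clique_extension (compatible f) [set u; w] Y -> compatible f u w.
Proof.
move=> cY /clique_extension2P[uY wY /cliqueP clY fuY fwY].
have expand x y : {in Y, forall z, compatible f x z} ->
    horner_node x y f = \sum_(z in Y) \sum_(z' in Y)
      horner_node z z' f * (lagrange_poly t Y z').[t x] *
      (lagrange_poly t Y z).[t y].
  move=> fxY; rewrite (horner_node_interpolation f x y cY).
  apply: eq_bigr => z zY.
  by rewrite (eqP (fxY z zY)) (horner_node_interpolation f z x cY) mulr_suml.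
rewrite /compatible (expand u w fuY) (expand w u fwY) exchange_big; apply/eqP.
apply: eq_bigr => z zY; apply: eq_bigr => z' z'Y; rewrite mulrAC.
congr (_ * _ * _); have [-> //|zz'] := eqVneq z z'.
exact/esym/eqP/clY.
Qed.

Lemma compatible_eq0 f (C : {set V}) :
  #|C| = d -> (forall x y, compatible f x y) ->
  {in C &, forall x y, horner_node x y f = 0} -> f = 0.
Proof.
move=> cC compat fC.
have f_eq0 x : {in C, forall y, horner_node x y f = 0} -> f x = 0.
  move=> fx; have size_fx : (size (f x) <= #|C|)%N by rewrite cC size_npoly.
  apply/val_inj; rewrite /= (lagrange_interpolation t_inj size_fx).
  by apply: big1 => y yC; rewrite -/(horner_node x y f) fx ?scale0r.
apply/ffunP => x; rewrite ffunE; apply: (f_eq0 x) => y yC.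
rewrite (eqP (compat x y)) /horner_node f_eq0 ?horner0 // => z zC.
exact: fC.
Qed.

Lemma leq_card_determining (A : finType) (ends : A -> V * V) :
  (d <= #|V|)%N ->
  (forall f, (forall a, compatible f (ends a).1 (ends a).2) ->
     forall x y, compatible f x y) ->
  (d * #|V| <= #|A| + 'C(d.+1, 2))%N.
Proof.
move=> dV determines; pose c (i : 'I_d) : V := enum_val (widen_ord dV i).
have c_inj : injective c.
  by move=> i j /enum_val_inj/(congr1 val) ij; apply: val_inj.
pose phi (k : A + {i : 'I_d & 'I_i.+1}) : {scalar {ffun V -> {poly_d F}}} :=
  match k with
  | inl a =>
      horner_node (ends a).1 (ends a).2 \- horner_node (ends a).2 (ends a).1
  | inr ij =>
      horner_node (c (tag ij)) (c (widen_ord (ltn_ord (tag ij)) (tagged ij)))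
  end.
have -> : (d * #|V|)%N = \dim {: {ffun V -> {poly_d F}}}.
  by rewrite dimvf mulnC -(dim_polyn F d) dimvf.
rewrite -card_tagged_ordS -card_sum.
apply: (leq_dim_separating (phi := phi)) => f phi0.
have compat : forall x y, compatible f x y.
  apply: determines => a; rewrite /compatible -subr_eq0; apply/eqP.
  exact: (phi0 (inl a)).
apply: (compatible_eq0 (C := c @: setT)) => //.
  by rewrite card_imset ?cardsT ?card_ord.
move=> _ _ /imsetP[i _ ->] /imsetP[j _ ->].
wlog ji : i j / (j <= i)%N.
  move=> wlog_ji; case: (leqP j i) => [|/ltnW] /wlog_ji // <-.
  exact/eqP/compat.
pose j' : 'I_i.+1 := Ordinal (ji : (j < i.+1)%N).
have := phi0 (inr (Tagged (fun i : 'I_d => 'I_i.+1) j')).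
by rewrite /=; congr (horner_node _ (c _) _ = _); apply: val_inj.
Qed.

End Compatibility.

Lemma wsat_lower_bound (V : finType) (d : nat) (e : rel V) :
  irreflexive e -> clique_extendable e setT 2 d ->
  (d * #|V| <= wsat e d.+2 + 'C(d.+1, 2))%N.
Proof.
move=> e_irr ext.
have [F /and3P[/subsetP sF _ cF] ->] := wsat_attained e (isT : (2 <= d.+2)%N).
have dV : (d <= #|V|)%N.
  by have [|C [<-]] := ext set0; rewrite ?cards0 ?max_card.
have /fin_all_exists[ends endsP] (g : {g | g \in F}) :
    exists p : V * V, val g = [set p.1; p.2].
  by have /edgesP[u [w [_ E]]] := sF _ (valP g); exists (u, w).
pose t (v : V) : rat := (enum_rank v)%:R.
have t_inj : injective t.
  by move=> u w /eqP; rewrite eqr_nat => /eqP/ord_inj/enum_rank_inj.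
rewrite -[#|F|]card_sig.
apply: (leq_card_determining t_inj dV (ends := ends)) => f f_ends.
have fF : subrel (edge_rel F) (compatible t f).
  move=> x y xyF; pose g : {g | g \in F} := exist _ [set x; y] xyF.
  have := f_ends g; have : [set x; y] = _ := endsP g.
  by case/set2_inj=> -[<- <-]; rewrite // compatibleC.
have f_closed : extension_closed d e (compatible t f).
  by move=> u w Y _; apply: compatible_extension.
have fe := completable_subrel e_irr (compatibleC t f) f_closed fF cF.
move=> x y; have [|Y [cY _ extY]] := ext [set x; y].
  by rewrite cards2; case: (_ != _).
exact: (compatible_extension t_inj cY (clique_extension_subrel fe extY)).
Qed.

Lemma good_card_gt0 (R : realType) (V : finType) (t : nat) (gamma : R)
    (e : rel V) :
  good t gamma e -> (0 < #|V|)%N.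
Proof.
move=> [_ P2]; rewrite lt0n; apply/negP => /eqP V0; have := P2 set0 set0.
rewrite V0 mulr0 mul0r cards0 lexx => /(_ _ isT isT)[|v [X []]].
  by rewrite disjoints_subset sub0set.
by rewrite inE.
Qed.

Lemma good_clique_extendable (R : realType) (V : finType) (t m d : nat)
    (gamma : R) (e : rel V) :
  0 < gamma -> good t gamma e -> (m <= t)%N -> (d <= t)%N ->
  clique_extendable e setT m d.
Proof.
move=> gamma_gt0 e_good mt dt X Xm; have V_gt0 := good_card_gt0 e_good.
have [P1 _] := e_good.
have [[|k] [Y [le_k YP _]]] := P1 X d (leq_trans Xm mt) dt.
  by move: le_k; rewrite leNgt mulr_gt0 ?ltr0n.
by have [cY extY] := YP ord0; exists (Y ord0); rewrite subsetT.
Qed.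

Theorem theorem3p3 (R : realType) (s : nat) (gamma : R) (V : finType)
    (e : rel V) (e_sym : symmetric e) (e_irr : irreflexive e) :
  (3 <= s)%N -> 0 < gamma -> good (2 * s) gamma e ->
  (wsat e s)%:Z = (s%:Z - 2) * #|V|%:Z - ('C(s - 1, 2))%:Z.
Proof.
case: s => [|[|d]] // _ gamma_gt0 e_good.
have ext m : (m <= 2 * d.+2)%N -> clique_extendable e setT m d.
  by move=> mt; apply: good_clique_extendable gamma_gt0 e_good mt _; lia.
have lower : (d * #|V| <= wsat e d.+2 + 'C(d.+1, 2))%N.
  by apply: wsat_lower_bound e_irr (ext 2%N _); lia.
have upper : (wsat e d.+2 + 'C(d.+1, 2) <= d * #|V|)%N.
  by apply: wsat_upper_bound e_sym e_irr (ext _ _); lia.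
by rewrite subSS subn0; lia.
Qed.
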